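(* For any $n\in\mathbb{N}$ with $n\ge 3$, the cycle graph $C_n$ on $n$ nodes satisfies $$\mathrm{fdim}(C_n)=\begin{cases}1, & \text{if } n\notin\{3,4,6\},\\ 2, & \text{if } n\in\{3,4,6\}.\end{cases}$$
   Context: $\mathbb{N}=\{0,1,2,\dots\}$. Graphs are undirected, without loops or multiple edges. A polytope $P\subset\mathbb{Q}^d$ is a lattice polytope if all its vertices are in $\mathbb{Z}^d$. A finite set $\mathcal{M}\subset\mathbb{Z}^d\setminus\{0\}$ is a set of moves if $\mathcal{M}=-\mathcal{M}$ and if for all $\lambda\in\mathbb{N}$ with $\lambda\ge 2$ and all $m\in\mathcal{M}$, $\lambda\cdot m\notin\mathcal{M}$. For a lattice polytope $P\subset\mathbb{Q}^d$ and a set of moves $\mathcal{M}\subset\mathbb{Z}^d$, the fiber graph $P(\mathcal{M})$ is the graph with node set $P\cap\mathbb{Z}^d$ in which two nodes $u$ and $v$ are adjacent if $u-v\in\mathcal{M}$. The fiber dimension $\mathrm{fdim}(G)$ of a graph $G$ is the smallest $d\in\mathbb{N}$ such that there exist a full dimensional (i.e. $d$-dimensional) lattice polytope $P\subset\mathbb{Q}^d_{\ge 0}$ and a set of moves $\mathcal{M}\subset\mathbb{Z}^d$ with $G\cong P(\mathcal{M})$. *)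

(* Defs.v *)
From HB Require Import structures.
From mathcomp Require Import all_boot all_order all_algebra.
From mathcomp Require Import boolp classical_sets cardinality.

Set Implicit Arguments.
Unset Strict Implicit.
Unset Printing Implicit Defensive.

Import Order.TTheory GRing.Theory Num.Theory.

Local Open Scope classical_set_scope.
Local Open Scope ring_scope.

Record graph := Graph {
  node :> Type;
  adj : rel node;
  adj_sym : symmetric adj;
  adj_irr : irreflexive adj }.

Definition graph_iso (G H : graph) : Prop :=
  exists f : G -> H, bijective f /\ forall x y, adj (f x) (f y) = adj x y.

(* The conjunct [i != j] only matters for [n = 1], where it removes the loop. *)
Definition cycle_adj (n : nat) : rel 'I_n := fun i j =>
  (i != j) && ((val j == i.+1 %% n)%N || (val i == j.+1 %% n)%N).

Lemma cycle_adj_sym n : symmetric (@cycle_adj n).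
Proof. by move=> i j; rewrite /cycle_adj eq_sym orbC. Qed.

Lemma cycle_adj_irr n : irreflexive (@cycle_adj n).
Proof. by move=> i; rewrite /cycle_adj eqxx. Qed.

Definition cycle_graph (n : nat) : graph :=
  Graph (@cycle_adj_sym n) (@cycle_adj_irr n).

Section Polytopes.
Variable d : nat.
Implicit Types (A P : set 'rV[rat]_d) (x v : 'rV[rat]_d).

Definition conv_hull A : set 'rV[rat]_d :=
  [set x | exists (k : nat) (a : 'I_k -> 'rV[rat]_d) (c : 'I_k -> rat),
     [/\ forall i, A (a i), forall i, 0 <= c i, \sum_i c i = 1
       & x = \sum_i c i *: a i]].

Definition affine_hull A : set 'rV[rat]_d :=
  [set x | exists (k : nat) (a : 'I_k -> 'rV[rat]_d) (c : 'I_k -> rat),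
     [/\ forall i, A (a i), \sum_i c i = 1 & x = \sum_i c i *: a i]].

Definition polytope P : Prop :=
  exists A : set 'rV[rat]_d, finite_set A /\ P = conv_hull A.

Definition dot (c : 'rV[rat]_d) x : rat := \sum_i c 0 i * x 0 i.

(* [[set v]] is a face: some inequality valid on [P] is tight exactly at [v]. *)
Definition vertex P v : Prop :=
  exists (c : 'rV[rat]_d) (b : rat),
    (forall x, P x -> dot c x <= b) /\ P `&` [set x | dot c x = b] = [set v].

Definition embed (z : 'rV[int]_d) : 'rV[rat]_d := map_mx intr z.

Definition lattice_polytope P : Prop :=
  polytope P /\ forall v, vertex P v -> range embed v.

(* The affine hull is a translate of a linear subspace of dimension [k]; the
   empty set has no dimension in this sense. *)
Definition has_dim P (k : nat) : Prop :=
  exists (x0 : 'rV[rat]_d) (U : {vspace 'rV[rat]_d}),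
    \dim U = k /\ affine_hull P = [set x0 + u | u in [set` U]].

Definition full_dimensional P : Prop := has_dim P d.

Definition nonneg_orthant : set 'rV[rat]_d := [set x | forall i, 0 <= x 0 i].

Record moves := Moves {
  moveset :> set 'rV[int]_d;
  moves_finite : finite_set moveset;
  moves_neq0 : ~ moveset 0;
  moves_opp : moveset = [set - m | m in moveset];
  moves_primitive :
    forall (l : nat) m, (2 <= l)%N -> moveset m -> ~ moveset (m *+ l) }.

Definition lattice_points P : set 'rV[int]_d := embed @^-1` P.

Definition fiber_adj P (M : moves) : rel (lattice_points P) :=
  fun u w => val u - val w \in (M : set _).

Lemma fiber_adj_sym P M : symmetric (@fiber_adj P M).
Proof.
have H (m : 'rV[int]_d) : (M : set _) m -> (M : set _) (- m).
  by move=> Mm; rewrite moves_opp; exists m.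
move=> u w; rewrite /fiber_adj.
by apply/idP/idP => /set_mem/H; rewrite opprB => /mem_set.
Qed.

Lemma fiber_adj_irr P M : irreflexive (@fiber_adj P M).
Proof.
by move=> u; apply/negbTE/negP => /set_mem; rewrite subrr; apply: moves_neq0.
Qed.

Definition fiber_graph P (M : moves) : graph :=
  Graph (@fiber_adj_sym P M) (@fiber_adj_irr P M).

End Polytopes.

Definition fiber_realizable (G : graph) (d : nat) : Prop :=
  exists (P : set 'rV[rat]_d) (M : moves d),
    [/\ lattice_polytope P, full_dimensional P, P `<=` @nonneg_orthant d
      & graph_iso G (fiber_graph P M)].

(* [fdim G = d], as a relation: [fdim G] is a minimum over dimensions [d]. *)
Definition is_fdim (G : graph) (d : nat) : Prop :=
  fiber_realizable G d /\
  forall e : nat, fiber_realizable G e -> (d <= e)%N.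

(* Main.v *)
Require Import Defs.
From mathcomp Require Import all_boot all_order all_algebra zify.
From mathcomp Require Import boolp classical_sets cardinality.

(** A one-dimensional fiber graph lives on consecutive integers, say [0, n), and
    its edges join the integers that differ by one of finitely many steps. If it
    is a cycle, every node has degree 2. At [0] this leaves exactly two steps
    [a < b], and at [b] or at [n - b] it excludes all but [a + b = n]
    ([two_regular_difference_steps]). Because no move is a multiple of another,
    [a] does not divide [b]; but for [n] = 3, 4, 6 every splitting [n = a + b]
    with [a < b] has [a] dividing [b], so dimension one is impossible.

    Conversely, if [a + b = n] then [i] and [i + a] modulo [n] always differ by
    [a] or by [- b], so that steps [a] and [b] turn [0, n) into the circulant graph
    of the residue [a]; this is a cycle of length [n] as soon as [a] is prime to
    [n] ([fiber_realizable1_coprime]). For [1 < a < b] such steps do not divide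
    each other, since a common divisor of both divides [n]; and such an [a] exists
    when [n] is not 3, 4 or 6, that is, when the totient of [n] exceeds 2
    ([coprime_step]).

    The exceptional cycles are fiber graphs of a triangle, a square and a 2 by 1
    rectangle in the plane. In dimension zero there is at most one node. *)

Set Implicit Arguments.
Unset Strict Implicit.
Unset Printing Implicit Defensive.

Import Order.TTheory GRing.Theory Num.Theory.

Local Open Scope classical_set_scope.
Local Open Scope ring_scope.

(** * Convex hulls *)

Section ConvexHull.
Variable d : nat.
Implicit Types (A : set 'rV[rat]_d) (x y c : 'rV[rat]_d).

Lemma dot_sum c k (r : 'I_k -> rat) (a : 'I_k -> 'rV[rat]_d) :
  dot c (\sum_i r i *: a i) = \sum_i r i * dot c (a i).
Proof.
rewrite /dot; under [LHS]eq_bigr => j _ do rewrite summxE mulr_sumr.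
rewrite exchange_big; apply: eq_bigr => i _; rewrite mulr_sumr.
by apply: eq_bigr => j _; rewrite mxE mulrCA.
Qed.

Lemma sub_conv_hull A x : A x -> conv_hull A x.
Proof.
move=> Ax; exists 1%N, (fun=> x), (fun=> 1).
by split=> //; rewrite big_ord1 ?scale1r.
Qed.

Lemma conv_hull_dot_ge A c (b : rat) :
  (forall a, A a -> b <= dot c a) ->
  forall x, conv_hull A x -> b <= dot c x.
Proof.
move=> Ab x [k [a [r [Aa r_ge0 r1 ->]]]].
rewrite dot_sum -[b]mul1r -r1 mulr_suml.
by apply: ler_sum => i _; apply: ler_wpM2l => //; apply: Ab.
Qed.

Lemma conv_hull_convex A x y (t : rat) :
  conv_hull A x -> conv_hull A y -> 0 <= t <= 1 ->
  conv_hull A ((1 - t) *: x + t *: y).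
Proof.
move=> [k [a [r [Aa r_ge0 r1 ->]]]] [l [b [s [Ab s_ge0 s1 ->]]]] /andP[t0 t1].
have splitl (i : 'I_k) : split (lshift l i) = inl i := unsplitK (inl i).
have splitr (i : 'I_l) : split (rshift k i) = inr i := unsplitK (inr i).
exists (k + l)%N, (fun i => match split i with inl i => a i | inr i => b i end),
  (fun i => match split i with inl i => (1 - t) * r i | inr i => t * s i end).
split.
- by move=> i; case: (split i).
- by move=> i; case: (split i) => j; rewrite mulr_ge0 ?subr_ge0.
- rewrite big_split_ord /=.
  under eq_bigr => i _ do rewrite splitl.
  under [X in _ + X = _]eq_bigr => i _ do rewrite splitr.
  by rewrite -!mulr_sumr r1 s1 !mulr1 subrK.
- rewrite big_split_ord /= !scaler_sumr; congr (_ + _); apply: eq_bigr => i _.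
    by rewrite splitl scalerA.
  by rewrite splitr scalerA.
Qed.

(** A strict inequality at every contributing generator would make the
    inequality strict at [v]; so some generator lies on the supporting
    hyperplane, which meets the hull in [v] only. *)
Lemma vertex_conv_hull A v : vertex (conv_hull A) v -> A v.
Proof.
move=> [c [b [le_b tight]]].
have [[k [a [r [Aa r_ge0 r1 def_v]]]] cv] : (conv_hull A `&` [set x | dot c x = b]) v.
  by rewrite tight.
have [i [ri ai]] : exists i, 0 < r i /\ dot c (a i) = b.
  apply: contrapT => no_i.
  have slack_eq0 : \sum_i r i * (b - dot c (a i)) = 0.
    under eq_bigr => i _ do rewrite mulrBr.
    by rewrite sumrB -mulr_suml r1 mul1r -dot_sum -def_v cv subrr.
  have slack_ge0 i : 0 <= r i * (b - dot c (a i)).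
    by rewrite mulr_ge0 // subr_ge0; apply/le_b/sub_conv_hull.
  have r0 i : r i = 0.
    move/eqP: slack_eq0; rewrite psumr_eq0 // => /allP/(_ i).
    rewrite mem_index_enum mulf_eq0 => /(_ isT)/orP[/eqP //|].
    rewrite subr_eq0 => /eqP bi; apply: contrapT => /eqP ri; apply: no_i.
    by exists i; rewrite lt_neqAle eq_sym ri r_ge0.
  by move: r1; rewrite big1 // => /esym/eqP; rewrite oner_eq0.
have : (conv_hull A `&` [set x | dot c x = b]) (a i).
  by split=> //; apply: sub_conv_hull.
by rewrite tight => <-; apply: Aa.
Qed.

(** The vertices of the unit simplex already span the space affinely, the origin
    taking up the weight that the coordinates leave. *)
Lemma full_dimensional_unit_simplex (P : set 'rV[rat]_d) :
  P 0 -> (forall j, P (delta_mx 0 j)) -> full_dimensional P.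
Proof.
move=> P0 Pe; exists 0, fullv; split.
  by rewrite dimvf dim_matrix; apply: mul1n.
apply/seteqP; split=> x _.
  by exists x; rewrite ?add0r //= memvf.
exists d.+1, (fun i => if unlift ord0 i is Some j then delta_mx 0 j else 0),
  (fun i => if unlift ord0 i is Some j then x 0 j else 1 - \sum_j x 0 j).
split.
- by move=> i; case: unliftP.
- rewrite big_ord_recl /= unlift_none.
  under [X in _ + X = _]eq_bigr => j _ do rewrite /= liftK.
  by rewrite subrK.
- rewrite big_ord_recl /= unlift_none scaler0 add0r.
  by under eq_bigr => j _ do rewrite /= liftK; apply: row_sum_delta.
Qed.

End ConvexHull.

Lemma embed_delta d (j : 'I_d) : embed (delta_mx 0 j) = delta_mx 0 j.
Proof. by apply/rowP => k; rewrite !mxE; case: andP. Qed.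

Lemma dot_embed d (c z : 'rV[int]_d) :
  dot (embed c) (embed z) = (\sum_j c 0 j * z 0 j)%:~R.
Proof.
by rewrite /dot rmorph_sum; apply: eq_bigr => j _; rewrite !mxE rmorphM.
Qed.

(** * Realizations *)

Section Realization.
Variables n d : nat.
Variable p : 'I_n -> 'rV[int]_d.

Let hull := conv_hull (range (@embed d \o p)).

Lemma lattice_hull_ge (c z : 'rV[int]_d) (b : int) :
  (forall i, b <= \sum_j c 0 j * p i 0 j) -> hull (embed z) ->
  b <= \sum_j c 0 j * z 0 j.
Proof.
move=> pb hz; rewrite -(ler_int rat) -dot_embed.
apply: conv_hull_dot_ge hz => _ [i _ <-].
by rewrite dot_embed ler_int.
Qed.

(** Taking the hull of all the intended nodes, and not of its vertices only,
    makes each of them a lattice point for free; what has to be checked is that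
    the hull contains no further lattice point. *)
Lemma fiber_realizable_hull (M : moves d) :
  injective p ->
  (forall i j, 0 <= p i 0 j) ->
  (forall z, hull (embed z) -> exists i, p i = z) ->
  (exists i, p i = 0) ->
  (forall j, exists i, p i = delta_mx 0 j) ->
  (forall i j, cycle_adj i j = (p i - p j \in (M : set _))) ->
  fiber_realizable (cycle_graph n) d.
Proof.
move=> p_inj p_ge0 p_onto p0 pe p_adj.
have hull_p i : hull (embed (p i)) by apply: sub_conv_hull; exists i.
exists hull, M; split.
- split; first by exists (range (@embed d \o p)); split=> //; apply: finite_image.
  by move=> v /vertex_conv_hull[i _ <-]; exists (p i).
- apply: full_dimensional_unit_simplex => [|j].
    by have [i pi0] := p0; have := hull_p i; rewrite pi0 /embed map_mx0.
  by have [i pij] := pe j; have := hull_p i; rewrite pij embed_delta.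
- move=> x hx j.
  have coordE (y : 'rV[rat]_d) : dot (delta_mx 0 j) y = y 0 j.
    rewrite /dot (bigD1 j) //= big1 => [|k /negbTE kj]; last first.
      by rewrite mxE kj andbF mul0r.
    by rewrite mxE !eqxx mul1r addr0.
  rewrite -coordE; apply: conv_hull_dot_ge hx => _ [i _ <-].
  by rewrite coordE mxE ler0z.
- have in_hull i : p i \in lattice_points hull by rewrite in_setE; apply: hull_p.
  have onto (w : lattice_points hull) : exists i, p i = val w.
    by apply: p_onto; have := valP w; rewrite in_setE.
  exists (fun i => Sub (p i) (in_hull i)); split; last first.
    by move=> i j; rewrite [RHS]p_adj.
  exists (fun w => projT1 (cid (onto w))) => [i|w].
    by case: cid => j /= /p_inj.
  by apply: val_inj => /=; case: cid.
Qed.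

End Realization.

Lemma moves_of_seq d (s : seq 'rV[int]_d) :
  0 \notin s -> (forall m, m \in s -> - m \in s) ->
  (forall (l : nat) m, (2 <= l)%N -> m \in s -> m *+ l \notin s) ->
  {M : moves d | forall m, (m \in (M : set _)) = (m \in s)}.
Proof.
move=> s0 sN sP.
have fin : finite_set [set` s] by apply/finite_seqP; exists s.
have opp : [set` s] = [set - m | m in [set` s]].
  apply/seteqP; split=> [m sm|_ [m sm <-]] /=; last exact: sN.
  by exists (- m); rewrite ?opprK //=; apply: sN.
have prim (l : nat) m : (2 <= l)%N -> [set` s] m -> ~ [set` s] (m *+ l).
  by move=> l2 sm; apply/negP/sP.
exists (Moves fin (negP s0) opp prim) => m.
by rewrite /= mem_setE.
Qed.

(** * Dimension one *)

Lemma rV1E (x : 'rV[int]_1) : x = const_mx (x 0 0).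
Proof. by apply/rowP => j; rewrite mxE ord1. Qed.

Lemma const_mx1_inj : injective (@const_mx int 1 1).
Proof. by move=> a b /rowP/(_ 0); rewrite !mxE. Qed.

(** A value [n] or more would, with everything below it, give more than [n]
    values. *)
Lemma ltn_downward_inj n (h : 'I_n -> nat) :
  injective h -> (forall i j, (j <= h i)%N -> exists k, h k = j) ->
  forall i, (h i < n)%N.
Proof.
move=> h_inj h_down i.
have inv (j : 'I_(h i).+1) : exists k, h k = j by apply: (h_down i); rewrite -ltnS.
pose g j := projT1 (cid (inv j)).
have hg j : h (g j) = j by rewrite /g; case: cid.
have g_inj : injective g by move=> j k gjk; apply: val_inj; rewrite /= -!hg gjk.
by have := leq_card g g_inj; rewrite !card_ord.
Qed.

(** The integer points of a convex subset of the line are consecutive, so the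
    vertices of the cycle are renamed by their distance to the leftmost one. *)
Lemma fiber_realizable1_relabel n :
  fiber_realizable (cycle_graph n) 1 ->
  exists (M : moves 1) (e : 'I_n -> 'I_n), bijective e /\
    forall k l, cycle_adj (e k) (e l) =
      (const_mx (k%:Z - l%:Z) \in (M : set 'rV[int]_1)).
Proof.
move=> [P [M [[[A [_ ->]] _] _ _ [f [f_bij f_adj]]]]].
exists M; case: n f f_bij f_adj => [|n] f f_bij f_adj.
  by exists id; split=> [|[]//]; exists id.
pose g i : int := val (f i) 0 0.
have fE i : val (f i) = const_mx (g i) by apply: rV1E.
have g_inj : injective g.
  by move=> i j gij; apply: (bij_inj f_bij); apply: val_inj; rewrite /= !fE gij.
case: (arg_minP (i0 := ord0) (P := predT) g isT) => i0 _ g_min.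
pose h i := `|g i - g i0|%N.
have gE i : g i = g i0 + (h i)%:Z.
  by rewrite /h gez0_abs ?subr_ge0 ?g_min // [RHS]addrC subrK.
have h_inj : injective h by move=> i j hij; apply: g_inj; rewrite (gE i) (gE j) hij.
have h_down i j : (j <= h i)%N -> exists k, h k = j.
  case: (posnP (h i)) => [->|h_gt0 jh].
    by rewrite leqn0 => /eqP ->; exists i0; rewrite /h subrr.
  have in_hull k : conv_hull A (embed (val (f k))).
    by have := valP (f k); rewrite in_setE.
  have hq0 : (h i)%:R != 0 :> rat by rewrite pnatr_eq0 -lt0n.
  (* The integer point at distance [j] divides the segment from the leftmost node
     to [f i] in the ratio [j / h i]. *)
  have z_in : const_mx (g i0 + j%:Z) \in lattice_points (conv_hull A).
    rewrite in_setE /lattice_points /=.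
    have t01 : 0 <= (j%:R / (h i)%:R : rat) <= 1.
      by rewrite divr_ge0 ?ler0n // ler_pdivrMr ?ltr0n // mul1r ler_nat.
    have := conv_hull_convex (in_hull i0) (in_hull i) t01.
    congr conv_hull; apply/rowP => k; rewrite !fE !mxE (gE i).
    rewrite !rmorphD /= -!pmulrn mulrDr mulrBl mul1r addrA subrK.
    by rewrite mulfVK.
  pose w : lattice_points (conv_hull A) := SigSub z_in.
  have [f' _ f'K] := f_bij.
  exists (f' w); rewrite /h /g f'K /= mxE addrC addKr.
  by rewrite absz_nat.
pose H i := Ordinal (ltn_downward_inj h_inj h_down i).
have H_inj : injective H by move=> i j [] /h_inj.
have [e He eH] := injF_bij H_inj.
exists e; split; first by exists H.
have ge k : g (e k) = g i0 + k%:Z by rewrite gE -[in RHS](eH k).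
move=> k l; rewrite -[LHS]f_adj.
apply: (congr1 (fun x => x \in (M : set _))); rewrite /= !fE !ge.
apply/rowP => j; rewrite !mxE.
by rewrite opprD addrACA subrr add0r.
Qed.

Lemma cycle_adj_two n (i : 'I_n) : (3 <= n)%N ->
  exists y z, y != z /\ forall w, cycle_adj i w = (w == y) || (w == z).
Proof.
move=> n3; have i_lt := ltn_ord i.
have [succ_neq neq_succ] : ordS i != i /\ ordS i != ord_pred i.
  split; apply/eqP => /(congr1 val) /=.
    have [lt|/esym eq] : (i.+1 < n)%N \/ n = i.+1 by lia.
      by rewrite modn_small //; lia.
    by rewrite eq modnn; lia.
  have [i0|i0] := posnP (nat_of_ord i).
    by rewrite i0 add0n !modn_small //; lia.
  have -> : (i + n).-1 = (i.-1 + n)%N by lia.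
  rewrite modnDr [RHS]modn_small; last by lia.
  have [lt|/esym eq] : (i.+1 < n)%N \/ n = i.+1 by lia.
    by rewrite modn_small //; lia.
  by rewrite eq modnn; lia.
exists (ordS i), (ord_pred i); split=> // w; rewrite /cycle_adj.
have -> : (val w == i.+1 %% n)%N = (w == ordS i) by [].
have -> : (val i == w.+1 %% n)%N = (w == ord_pred i).
  have -> : (val i == w.+1 %% n)%N = (i == ordS w) by [].
  by apply/eqP/eqP => ->; rewrite ?ordSK ?ord_predK.
case: (eqVneq i w) => //= <-; rewrite eq_sym (negbTE succ_neq) /=.
by apply/esym/negP => /eqP ip; move: succ_neq; rewrite [X in ordS X]ip ord_predK eqxx.
Qed.

(** In a 2-regular difference graph on [0, n), the neighbours of [0] are the two
    steps [a < b]. If [n < a + b], the vertex [n - b] has only [n - b + a] as a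
    neighbour; if [a + b < n], the vertex [b] has the three neighbours [0],
    [b - a] and [b + a]. *)
Lemma two_regular_difference_steps n (D : int -> bool) :
  (0 < n)%N -> ~~ D 0 -> (forall x, D (- x) = D x) ->
  (forall k : 'I_n, exists y z : 'I_n, y != z /\
     forall w : 'I_n, D (k%:Z - w%:Z) = (w == y) || (w == z)) ->
  exists a b : nat, [/\ (0 < a < b)%N, (a + b)%N = n, D a & D b].
Proof.
move=> n0 D0 DN reg.
have [a [b [a_lt_b b_lt_n Dn]]] : exists a b : nat, [/\ (a < b)%N, (b < n)%N &
    forall t : nat, (t < n)%N -> D t%:Z = (t == a) || (t == b)].
  have [y [z [yz Dyz]]] := reg (Ordinal n0).
  have Dt (t : nat) : (t < n)%N -> D t%:Z = (t == y) || (t == z).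
    by move=> tn; rewrite -DN -[- _]add0r; apply: (Dyz (Ordinal tn)).
  have : (y < z)%N \/ (z < y)%N by move: yz; rewrite -val_eqE /=; lia.
  case=> lt; first by exists y, z.
  by exists z, y; split=> // t tn; rewrite Dt // orbC.
have a0 : (0 < a)%N.
  by rewrite lt0n; apply/eqP => a0; move: D0; rewrite (Dn 0%N) // a0 eqxx.
have Da : D a by rewrite Dn ?eqxx //; lia.
have Db : D b by rewrite Dn ?eqxx ?orbT.
exists a, b; split=> //; first by rewrite a0.
have Dsub (x y : nat) : D (x%:Z - y%:Z) -> (x < n)%N -> (y < n)%N ->
    [\/ x = (y + a)%N, y = (x + a)%N, x = (y + b)%N | y = (x + b)%N].
  move=> Dxy xn yn; have [le|/ltnW le] := leqP y x.
    move: Dxy; rewrite subzn // Dn; last by lia.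
    by case/orP => /eqP ?; [constructor 1 | constructor 3]; lia.
  move: Dxy; rewrite -DN opprB subzn // Dn; last by lia.
  by case/orP => /eqP ?; [constructor 2 | constructor 4]; lia.
case: (ltngtP (a + b) n) => // ab.
- have [y [z [_ Db3]]] := reg (Ordinal b_lt_n).
  have nb_lt : (b - a < n)%N by lia.
  have := Db3 (Ordinal n0); have := Db3 (Ordinal nb_lt); have := Db3 (Ordinal ab).
  rewrite -!val_eqE /= subr0 Db.
  have -> : b%:Z - (b - a)%N%:Z = a by lia.
  have -> : b%:Z - (a + b)%N%:Z = - a%:Z by lia.
  by rewrite DN Da; lia.
- have k_lt : (n - b < n)%N by lia.
  have [y [z [yz Dk]]] := reg (Ordinal k_lt).
  have := Dk y; have := Dk z; rewrite !eqxx orbT /=.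
  move=> /Dsub/(_ k_lt (ltn_ord z)) Hz /Dsub/(_ k_lt (ltn_ord y)) Hy.
  case/eqP: yz; apply: val_inj => /=.
  by have := ltn_ord y; have := ltn_ord z; case: Hz; case: Hy; lia.
Qed.

(** The divisibility [a %| b] would make the move [b] a proper multiple of the
    move [a]. *)
Lemma fiber_realizable1_steps n : (3 <= n)%N ->
  fiber_realizable (cycle_graph n) 1 ->
  exists a b : nat, [/\ (0 < a < b)%N, (a + b)%N = n & ~~ (a %| b)%N].
Proof.
move=> n3 /fiber_realizable1_relabel[M [e [[e' eK e'K] eM]]].
pose D x := (const_mx x : 'rV[int]_1) \in (M : set _).
have DN x : D (- x) = D x.
  have half y : D y -> D (- y).
    rewrite /D !in_setE {2}moves_opp => My; exists (const_mx y) => //.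
    by apply/rowP => j; rewrite !mxE.
  by apply/idP/idP => /half; rewrite ?opprK.
have [||k|a [b [ab abn Da Db]]] := @two_regular_difference_steps n D _ _ DN.
- by lia.
- by apply/negP; rewrite /D in_setE => /moves_neq0.
- have [y [z [yz adj]]] := cycle_adj_two (e k) n3.
  exists (e' y), (e' z); split; first by rewrite (can_eq e'K).
  by move=> w; rewrite /D -eM adj -!(can2_eq eK e'K).
exists a, b; split=> //; apply/negP => /dvdnP[l bl].
move: Da Db; rewrite /D !in_setE => Ma Mb.
apply: (@moves_primitive _ M l _ _ Ma); first by case: l bl => [|[|l]]; lia.
suff <- : const_mx b%:Z = const_mx a%:Z *+ l :> 'rV[int]_1 by [].
by apply/rowP => j; rewrite mulmxnE !mxE bl -mulr_natl PoszM natz.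
Qed.

Lemma cycle_adjE n (i j : 'I_n) : (1 < n)%N ->
  cycle_adj i j = (val j == i.+1 %% n)%N || (val i == j.+1 %% n)%N.
Proof.
move=> n1; rewrite /cycle_adj; case: (eqVneq i j) => //= <-.
rewrite orbb; apply/esym/eqP; have i_lt := ltn_ord i.
have [lt|eq] : (i.+1 < n)%N \/ i.+1 = n by lia.
  by rewrite modn_small //; lia.
by rewrite eq modnn; lia.
Qed.

(** On residues in [0, a + b), adding [a] modulo [a + b] either adds [a] or
    subtracts [b]; so the steps [a] and [b] join [i * a] to [(i + 1) * a], and
    the cycle visits every residue because [a] is a unit. *)
Lemma fiber_realizable1_coprime n a b :
  (1 < a < b)%N -> (a + b)%N = n -> coprime a n ->
  fiber_realizable (cycle_graph n) 1.
Proof.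
move=> ab abn co_an.
have n0 : (0 < n)%N by lia.
have a_ndvd_b : ~~ (a %| b)%N.
  apply/negP => dvd_b; have dvd_n : (a %| n)%N by rewrite -abn dvdn_addr.
  by move: co_an; rewrite /coprime (gcdn_idPl dvd_n); lia.
have b_ndvd_a : ~~ (b %| a)%N by apply/negP => /dvdn_leq; lia.
pose s : seq 'rV[int]_1 := map const_mx [:: a%:Z; b%:Z; - a%:Z; - b%:Z].
have const_s x : (const_mx x \in s) = (x \in [:: a%:Z; b%:Z; - a%:Z; - b%:Z]).
  exact/mem_map/const_mx1_inj.
have [|m|l m l2|M Ms] := @moves_of_seq 1 s.
- rewrite -[0](_ : const_mx 0 = 0); last by apply/rowP => j; rewrite !mxE.
  by rewrite const_s !inE; lia.
- rewrite [m]rV1E; move: (m 0 0) => x.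
  have -> : - const_mx x = const_mx (- x) :> 'rV[int]_1.
    by apply/rowP => j; rewrite !mxE.
  by rewrite !const_s !inE; lia.
- rewrite [m]rV1E; move: (m 0 0) => x.
  have -> : const_mx x *+ l = const_mx (l%:Z * x) :> 'rV[int]_1.
    by apply/rowP => j; rewrite mulmxnE !mxE -mulr_natl natz.
  rewrite !const_s !inE => xs; apply/negP => lxs.
  have absE : `|(l%:Z * x)%R|%N = (l * `|x|)%N by rewrite abszM absz_nat.
  have [[xa|xb] [la|lb]] : (`|x|%N = a \/ `|x|%N = b) /\
      ((l * `|x|)%N = a \/ (l * `|x|)%N = b).
    by rewrite -absE; split; [clear lxs | clear xs]; lia.
  + by move: la; rewrite xa; nia.
  + by case/negP: a_ndvd_b; apply/dvdnP; exists l; rewrite -lb xa.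
  + by case/negP: b_ndvd_a; apply/dvdnP; exists l; rewrite -la xb.
  + by move: lb; rewrite xb; nia.
pose r (i : 'I_n) := Ordinal (ltn_pmod (i * a) n0).
have cancel_a (x y : nat) : (x * a == y * a %[mod n]) = (x == y %[mod n]).
  wlog le_yx : x y / (y <= x)%N => [hw|].
    by case: (leqP y x) => [/hw //|/ltnW /hw]; rewrite eq_sym => ->; rewrite eq_sym.
  by rewrite !eqn_mod_dvd ?leq_mul2r ?le_yx ?orbT // -mulnBl Gauss_dvdl // coprime_sym.
have r_inj : injective r.
  move=> i j [] /eqP; rewrite cancel_a !modn_small // => /eqP ij.
  exact: val_inj.
have r_onto (k : nat) : (k < n)%N -> exists i, nat_of_ord (r i) = k.
  move=> kn; have [r' _ r'K] := injF_bij r_inj.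
  by exists (r' (Ordinal kn)); rewrite r'K.
have step (i j : 'I_n) : (val j == i.+1 %% n)%N =
    ((r j)%:Z - (r i)%:Z \in [:: a%:Z; - b%:Z]).
  have -> : (val j == i.+1 %% n)%N = (nat_of_ord (r j) == (r i + a) %% n)%N.
    rewrite /= modnDml -mulSnr cancel_a.
    by rewrite (modn_small (ltn_ord j)).
  have := ltn_ord (r j); have := ltn_ord (r i); rewrite !inE.
  move: (nat_of_ord (r i)) (nat_of_ord (r j)) => x y xn yn.
  have [lt|ge] := ltnP (x + a) n; first by rewrite modn_small //; lia.
  have -> : (x + a)%N = (x - b + n)%N by lia.
  by rewrite modnDr modn_small //; lia.
apply: (@fiber_realizable_hull n 1 (fun i => const_mx (r i)%:Z) M).
- by move=> i j /const_mx1_inj[ij]; apply/r_inj/val_inj.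
- by move=> i j; rewrite mxE.
- move=> z hz.
  have sumE c (x : 'rV[int]_1) :
      \sum_j (const_mx c : 'rV_1) 0 j * x 0 j = c * x 0 0.
    by rewrite big_ord1 mxE.
  have z0 : 0 <= 1 * z 0 0.
    by rewrite -sumE; apply: lattice_hull_ge hz => i; rewrite sumE mxE mul1r.
  have zn : 1 - n%:Z <= -1 * z 0 0.
    rewrite -sumE; apply: lattice_hull_ge hz => i; rewrite sumE mxE.
    by have := ltn_ord (r i); lia.
  have [|i ri] := r_onto `|(z 0 0)%R|%N; first by lia.
  by exists i; rewrite [z]rV1E; congr const_mx; rewrite ri gez0_abs //; lia.
- have [i ri] := r_onto 0%N n0; exists i; apply/rowP => j; rewrite !mxE.
  by rewrite ri.
- have [|i ri] := r_onto 1%N; first by lia.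
  move=> j; exists i; apply/rowP => k; rewrite !mxE !ord1 !eqxx.
  by rewrite ri.
- move=> i j; rewrite Ms cycle_adjE; last by lia.
  rewrite (_ : _ - _ = const_mx ((r i)%:Z - (r j)%:Z)); last first.
    by apply/rowP => k; rewrite !mxE.
  by rewrite const_s !step !inE; lia.
Qed.

(** For odd [n] the step 2 works; for even [n], the largest odd number below
    [n / 2] does: it differs from [n / 2] by 1 or 2, so its only possible common
    divisors with [n / 2] are 1 and 2. *)
Lemma coprime_step n : (3 <= n)%N -> n \notin [:: 3; 4; 6]%N ->
  exists a b : nat, [/\ (1 < a < b)%N, (a + b)%N = n & coprime a n].
Proof.
move=> n3; rewrite !inE => nn.
have [odd_n|even_n] := boolP (odd n).
  by exists 2%N, (n - 2)%N; split; rewrite ?coprime2n //; lia.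
pose k := n./2; have nE : n = k.*2 by have := odd_double_half n; rewrite (negbTE even_n).
have [odd_k|even_k] := boolP (odd k).
  exists (k - 2)%N, (k + 2)%N; split; rewrite ?nE; try lia.
  rewrite -mul2n coprimeMr coprimen2.
  have odd_k2 : odd (k - 2) by lia.
  rewrite odd_k2 -[X in coprime _ X](@subnK 2 k); last by lia.
  by rewrite /coprime gcdnDl -/(coprime _ _) coprimen2.
exists k.-1, k.+1; split; rewrite ?nE; try lia.
rewrite -mul2n coprimeMr coprimen2.
have -> : odd k.-1 by lia.
by rewrite -[X in coprime _ X](@prednK k) ?coprimenS //; lia.
Qed.

(** * Dimension two *)

(** A pair of integers supports computation, which a matrix does not. *)
Definition vec2 (x : int * int) : 'rV[int]_2 :=
  \row_j (if j == 0 then x.1 else x.2).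

Lemma vec2E (z : 'rV[int]_2) : z = vec2 (z 0 0, z 0 1).
Proof.
apply/rowP => j; rewrite mxE /=; case: (eqVneq j 0) => [->//|j0].
by congr (z _ _); apply: val_inj; case: j j0 => [[|[|]]].
Qed.

Lemma vec2_inj : injective vec2.
Proof.
move=> [x y] [x' y'] E; move/rowP: (E) => /(_ 0); move/rowP: E => /(_ 1).
by rewrite !mxE /= => -> ->.
Qed.

(** A vector with an entry [1] or [-1] is not a proper multiple of an integer
    vector, so any symmetric set of such vectors is a set of moves. *)
Lemma moves_of_pairs (s : seq (int * int)) :
  all (fun x => (- x.1, - x.2) \in s) s ->
  all (fun x => (`|x.1| == 1) || (`|x.2| == 1))%N s ->
  {M : moves 2 | forall m, (vec2 m \in (M : set _)) = (m \in s)}.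
Proof.
move=> /allP sN /allP s1.
have vec_s x : (vec2 x \in map vec2 s) = (x \in s) := mem_map vec2_inj s x.
have [|m|l m l2|M Ms] := @moves_of_seq 2 (map vec2 s).
- rewrite [0]vec2E !mxE vec_s; apply/negP => /s1; by [].
- rewrite [m]vec2E; move: (m 0 0, m 0 1) => x.
  have -> : - vec2 x = vec2 (- x.1, - x.2).
    by apply/rowP => j; rewrite !mxE; case: ifP.
  by rewrite !vec_s; apply: sN.
- rewrite [m]vec2E; move: (m 0 0, m 0 1) => x.
  have -> : vec2 x *+ l = vec2 (l%:Z * x.1, l%:Z * x.2).
    by apply/rowP => j; rewrite mulmxnE !mxE; case: ifP; rewrite -mulr_natl natz.
  rewrite !vec_s => _; apply/negP => /s1 /=; rewrite !abszM absz_nat !muln_eq1.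
  by case: l l2 => [|[]].
by exists M => m; rewrite Ms.
Qed.

(** The fifth hypothesis expresses that the hull of [l] has no lattice point
    outside [l], in a form where a few facet inequalities settle the matter. *)
Lemma fiber_realizable2_points (l s : seq (int * int)) :
  all (fun x => (- x.1, - x.2) \in s) s ->
  all (fun x => (`|x.1| == 1) || (`|x.2| == 1))%N s ->
  uniq l ->
  all (fun x => (0 <= x.1) && (0 <= x.2)) l ->
  (forall x : int * int,
     (forall (c : int * int) b,
        all (fun y => b <= c.1 * y.1 + c.2 * y.2) l ->
        b <= c.1 * x.1 + c.2 * x.2) -> x \in l) ->
  {subset [:: (0, 0); (1, 0); (0, 1)] <= l} ->
  (forall i j : 'I_(size l), cycle_adj i j =
     let x := nth (0, 0) l i in let y := nth (0, 0) l j in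
     ((x.1 - y.1, x.2 - y.2) \in s)) ->
  fiber_realizable (cycle_graph (size l)) 2.
Proof.
move=> sN s1 l_uniq l_ge0 l_closed l_unit l_adj.
have [M Ms] := moves_of_pairs sN s1.
pose q (i : 'I_(size l)) := nth (0, 0) l i.
have q_in i : q i \in l by apply: mem_nth.
have q_onto x : x \in l -> exists i, q i = x.
  move=> xl; have lt : (index x l < size l)%N by rewrite index_mem.
  by exists (Ordinal lt); apply: nth_index.
have sumE c x : \sum_j (vec2 c) 0 j * (vec2 x) 0 j = c.1 * x.1 + c.2 * x.2.
  by rewrite big_ord_recl big_ord1 !mxE.
apply: (@fiber_realizable_hull _ 2 (vec2 \o q) M).
- move=> i j /vec2_inj/eqP; rewrite nth_uniq // => /eqP; exact: val_inj.
- by move=> i j; rewrite mxE; have /andP[] := allP l_ge0 _ (q_in i); case: ifP.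
- move=> z; rewrite [z]vec2E; move: (z 0 0, z 0 1) => x hx.
  suff /q_onto[i <-] : x \in l by exists i.
  apply: l_closed => c b /allP lb; rewrite -sumE; apply: lattice_hull_ge hx => i.
  by rewrite sumE; apply: lb.
- have [|i qi] := q_onto (0, 0); first by apply: l_unit; rewrite !inE.
  by exists i; rewrite /= qi; apply/rowP => j; rewrite !mxE; case: ifP.
- move=> j; have [|i qi] := q_onto ((j == 0)%:Z, (j != 0)%:Z).
    by apply: l_unit; case: (j == 0).
  exists i; rewrite /= qi; apply/rowP => k; rewrite !mxE eqxx /=.
  by have := ltn_ord j; have := ltn_ord k; rewrite -!val_eqE /=; case: ifP; lia.
- move=> i j; rewrite l_adj /= -Ms.
  apply: (congr1 (fun x => x \in (M : set _))).
  by apply/rowP => k; rewrite !mxE /=; case: ifP.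
Qed.

(** The unit triangle, where any two lattice points differ by a move. *)
Lemma fiber_realizable2_C3 : fiber_realizable (cycle_graph 3) 2.
Proof.
apply: (@fiber_realizable2_points [:: (0, 0); (1, 0); (0, 1)]
  [:: (1, 0); (-1, 0); (0, 1); (0, -1); (1, -1); (-1, 1)]) => //.
- move=> [x y] /= ineq.
  have := ineq (1, 0) 0 isT; have := ineq (0, 1) 0 isT.
  have := ineq (-1, -1) (-1) isT.
  by rewrite !inE !xpair_eqE /=; lia.
- by do 2![case=> [[|[|[|//]]] ?]].
Qed.

(** The unit square with its sides. *)
Lemma fiber_realizable2_C4 : fiber_realizable (cycle_graph 4) 2.
Proof.
apply: (@fiber_realizable2_points [:: (0, 0); (1, 0); (1, 1); (0, 1)]
  [:: (1, 0); (-1, 0); (0, 1); (0, -1)]) => //.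
- move=> [x y] /= ineq.
  have := ineq (1, 0) 0 isT; have := ineq (0, 1) 0 isT.
  have := ineq (-1, 0) (-1) isT; have := ineq (0, -1) (-1) isT.
  by rewrite !inE !xpair_eqE /=; lia.
- by move=> x; rewrite !inE => /or3P[] /eqP ->.
- by do 2![case=> [[|[|[|[|//]]]] ?]].
Qed.

(** The rectangle [0, 2] x [0, 1]: the move (1, 0) joins each row into a path, and
   (2, 1) and (2, -1), its diagonals, join the ends of the two paths crosswise. *)
Lemma fiber_realizable2_C6 : fiber_realizable (cycle_graph 6) 2.
Proof.
apply: (@fiber_realizable2_points
  [:: (0, 0); (1, 0); (2, 0); (0, 1); (1, 1); (2, 1)]
  [:: (1, 0); (-1, 0); (2, 1); (-2, -1); (2, -1); (-2, 1)]) => //.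
- move=> [x y] /= ineq.
  have := ineq (1, 0) 0 isT; have := ineq (0, 1) 0 isT.
  have := ineq (-1, 0) (-2) isT; have := ineq (0, -1) (-1) isT.
  by rewrite !inE !xpair_eqE /=; lia.
- by move=> x; rewrite !inE => /or3P[] /eqP ->.
- by do 2![case=> [[|[|[|[|[|[|//]]]]]] ?]].
Qed.

(** * Conclusion *)

Lemma not_fiber_realizable0 n : (1 < n)%N -> ~ fiber_realizable (cycle_graph n) 0.
Proof.
case: n => [|[|n]] // _ [P [M [_ _ _ [f [f_bij _]]]]].
suff : f ord0 = f ord_max by move/(bij_inj f_bij).
by apply: val_inj; apply/rowP => -[].
Qed.

Local Close Scope ring_scope.
Local Close Scope classical_set_scope.

Theorem proposition4p4 (n : nat) (hn : 3 <= n) :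
  is_fdim (cycle_graph n) (if n \in [:: 3; 4; 6] then 2 else 1).
Proof.
have not0 : ~ fiber_realizable (cycle_graph n) 0.
  by apply: not_fiber_realizable0; apply: ltnW.
case: ifPn => n346; split.
- move: n346; rewrite !inE => /or3P[] /eqP ->.
  + exact: fiber_realizable2_C3.
  + exact: fiber_realizable2_C4.
  + exact: fiber_realizable2_C6.
- case=> [|[|]] // /fiber_realizable1_steps-/(_ hn)[a [b [ab abn /negP]]]; case.
  (* Besides 1, which divides anything, only the pair (2, 4) has to be checked. *)
  have [->|a2] : a = 1%N \/ a = 2%N by move: n346; rewrite !inE; lia.
    exact: dvd1n.
  by have [-> ->] : a = 2%N /\ b = 4%N by move: n346; rewrite !inE; lia.
- have [a [b [ab abn co_an]]] := coprime_step hn n346.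
  exact: fiber_realizable1_coprime ab abn co_an.
- by case.
Qed.
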